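(* Let $G_S$ be a self-loop graph of order $N$ with $|S|\ge 1$, and let $\lambda_1\ge\lambda_2\ge\cdots\ge\lambda_N$ be the eigenvalues (with multiplicity) of $\mathcal{L}(G_S)$. Let $\widetilde G$ be the Açıkmeşe lift of $G_S$, and let $\mu_1\ge\mu_2\ge\cdots\ge\mu_{2N+1}$ be the eigenvalues (with multiplicity) of $\mathcal{L}(\widetilde G)$. Then $$\lambda_i=\mu_{2i},\qquad i=1,2,\dots,N.$$ Moreover, for fixed $c\in\mathbb{R}$, writing $\delta_c(A)=\max_{\alpha\in\mathrm{Spec}(A)}|\alpha-c|$ for a real symmetric matrix $A$, one has $$\delta_c(\mathcal{L}(\widetilde G))=\delta_c(M_{sym})\ge\delta_c(\mathcal{L}(G_S)).$$
   Context: Let $G$ be a finite undirected simple graph with vertex set $V=\{1,\dots,N\}$ (possibly disconnected), and $S\subseteq V$. The self-loop graph $G_S$ is obtained from $G$ by attaching one loop at every vertex of $S$; $\sigma=|S|$. The loop vector $s\in\mathbb{R}^N$ is the indicator vector of $S$. $\mathcal{L}(G)=D(G)-A(G)$ is the ordinary Laplacian and $\mathcal{L}(G_S):=\mathcal{L}(G)+\mathrm{diag}(s)$. For $\sigma\ge1$, the Açıkmeşe lift $\widetilde G=(\widetilde V,\widetilde E)$ of $G_S$ is the simple graph on $\widetilde V=\{1,\dots,2N+1\}$ such that: for each edge $\{i,j\}$ of $G$, both $\{i,j\}$ and $\{i+N+1,j+N+1\}$ are edges of $\widetilde G$; for each $i\in S$, both $\{i,N+1\}$ and $\{N+1,i+N+1\}$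 are edges; there are no other edges. $\mathcal{L}(\widetilde G)$ is the ordinary Laplacian of $\widetilde G$. $M_{sym}$ is the $(N+1)\times(N+1)$ real symmetric matrix $M_{sym}=\begin{pmatrix}2\sigma&-\sqrt2\,s^\top\\ -\sqrt2\,s&\mathcal{L}(G_S)\end{pmatrix}$. *)

(* Defs.v *)
From HB Require Import structures.
From mathcomp Require Import all_boot all_order all_algebra.
From mathcomp Require Import complex polyrcf reals.

Set Implicit Arguments.
Unset Strict Implicit.
Unset Printing Implicit Defensive.

Import Order.TTheory GRing.Theory Num.Theory.
Local Open Scope ring_scope.

Record sgraph (n : nat) := SGraph {
  edge :> rel 'I_n;
  edge_sym : symmetric edge;
  edge_irr : irreflexive edge }.

Section Matrices.
Variables (R : rcfType) (n : nat).
Implicit Types (G : sgraph n) (S : {set 'I_n}).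

Definition adjacency G : 'M[R]_n := \matrix_(i, j) (G i j)%:R.

Definition degree_mx G : 'M[R]_n := diag_mx (\row_i #|[set j | G i j]|%:R).

Definition laplacian G : 'M[R]_n := degree_mx G - adjacency G.

Definition loop_vec S : 'cV[R]_n := \col_i (i \in S)%:R.

Definition loop_laplacian G S : 'M[R]_n := laplacian G + diag_mx (loop_vec S)^T.

Definition Msym G S : 'M[R]_(1 + n) :=
  block_mx (2 * #|S|%:R)%:M                 (- Num.sqrt 2 *: (loop_vec S)^T)
           (- Num.sqrt 2 *: loop_vec S)     (loop_laplacian G S).

End Matrices.

Section Lift.
Variables (N : nat) (G : sgraph N) (S : {set 'I_N}).

(* With vertices numbered from 0, the values of [copy1 i], [hub] and [copy2 i]
   are i, N and i + N + 1, and N + (1 + N) = 2N + 1. *)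
Definition copy1 (i : 'I_N) : 'I_(N + (1 + N)) := lshift (1 + N) i.
Definition hub : 'I_(N + (1 + N)) := rshift N (lshift N ord0).
Definition copy2 (i : 'I_N) : 'I_(N + (1 + N)) := rshift N (rshift 1 i).

Definition lift_rel : rel 'I_(N + (1 + N)) := fun x y =>
  [exists i, exists j, G i j &&
     (((x, y) == (copy1 i, copy1 j)) || ((x, y) == (copy2 i, copy2 j)))]
  || [exists i in S, (x, y) \in
       [:: (copy1 i, hub); (hub, copy1 i); (hub, copy2 i); (copy2 i, hub)]].

Lemma lift_rel_sym : symmetric lift_rel.
Proof.
suff sub x y : lift_rel x y -> lift_rel y x by move=> x y; apply/idP/idP; apply: sub.
case/orP=> [/existsP[i /existsP[j /andP[Gij xy]]] | /existsP[i /andP[Si xy]]].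
  apply/orP; left; apply/existsP; exists j; apply/existsP; exists i.
  rewrite edge_sym Gij /=; move: xy; rewrite !xpair_eqE.
  by case/orP=> /andP[-> ->]; rewrite ?orbT.
apply/orP; right; apply/existsP; exists i; rewrite Si /=.
move: xy; rewrite !inE !xpair_eqE.
by case/or4P=> /andP[-> ->]; rewrite ?orbT.
Qed.

Lemma lift_rel_irr : irreflexive lift_rel.
Proof.
move=> x; apply/negP.
case/orP=> [/existsP[i /existsP[j /andP[Gij]]] | /existsP[i /andP[_]]].
  rewrite !xpair_eqE; case/orP=> /andP[/eqP-> /eqP] => [/lshift_inj | /rshift_inj/rshift_inj] eij;
  by move: Gij; rewrite eij edge_irr.
have n1 : copy1 i != hub by rewrite -val_eqE /= addn0 ltn_eqF.
have n2 : copy2 i != hub by rewrite -val_eqE /= eqn_add2l.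
rewrite !inE !xpair_eqE.
by case/or4P=> /andP[/eqP-> /eqP e]; move: n1 n2; rewrite e eqxx.
Qed.

Definition acikmese_lift : sgraph (N + (1 + N)) := SGraph lift_rel_sym lift_rel_irr.

End Lift.

Section Spectrum.
Variable R : rcfType.

(* The eigenvalues in R of A, in nonincreasing order, each repeated according to
   its multiplicity as a root of the characteristic polynomial; [eigenvaluesP]
   shows that no eigenvalue is lost when A is symmetric. *)
Definition eigenvalues n (A : 'M[R]_n) : seq R :=
  sort >=%O (flatten [seq nseq (mup x (char_poly A)) x | x <- rootsR (char_poly A)]).

Lemma symmetric_char_poly_split n (A : 'M[R]_n) : A^T = A ->
  exists s : seq R, char_poly A = \prod_(x <- s) ('X - x%:P).
Proof.
move=> Asym; pose f := real_complex R; pose B := map_mx f A.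
have Bherm : B \is hermsymmx.
  apply: realsym_hermsym.
    by apply/is_hermitianmxP; rewrite expr0 scale1r map_mx_id // map_trmx Asym.
  by apply/mxOverP => i j; rewrite mxE; apply/complex_realP; exists (A i j).
have spR := hermitian_spectral_diag_real Bherm.
have /orthomx_spectralP := hermitian_normalmx Bherm.
set P := spectralmx B; set d := spectral_diag B in spR * => BE.
have Pu : P \in unitmx by apply: spectral_unit.
have cBd : char_poly B = char_poly (diag_mx d).
  rewrite BE /char_poly /char_poly_mx !map_mxM map_invmx.
  set Q := map_mx _ P; have Qu : Q \in unitmx by rewrite map_unitmx.
  rewrite -[X in X - _](_ : invmx Q *m 'X%:M *m Q = 'X%:M); last first.
    by rewrite mul_mx_scalar -scalemxAl mulVmx // scalemx1.
  by rewrite -mulmxBl -mulmxBr !det_mulmx mulrAC -det_mulmx mulVmx // det1 mul1r.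
exists [seq complex.Re (d ord0 i) | i <- enum 'I_n].
apply: (@map_poly_inj _ _ f); rewrite map_char_poly -/B cBd.
rewrite char_poly_trig ?diag_mx_is_trig // big_map big_enum rmorph_prod /=.
apply: eq_bigr => i _; rewrite mxE eqxx mulr1n rmorphB /= map_polyX map_polyC /=.
have /mxOverP/(_ ord0 i)/complex_realP[k ->] := spR; by [].
Qed.

Lemma eigenvaluesP n (A : 'M[R]_n) : A^T = A ->
  char_poly A = \prod_(x <- eigenvalues A) ('X - x%:P).
Proof.
case/symmetric_char_poly_split => s sE.
have p0 : char_poly A != 0 by rewrite monic_neq0 ?char_poly_monic.
suff /(perm_big _) -> : perm_eq (eigenvalues A) s by [].
rewrite perm_sort; apply/allP => x _ /=; apply/eqP.
rewrite -[RHS]mu_prod_XsubC -sE count_flatten -map_comp sumnE big_map.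
have [rx | nrx] := boolP (x \in rootsR (char_poly A)); last first.
  rewrite mupNroot; last by move: nrx; rewrite -(roots_on_rootsR p0) in_itv.
  rewrite big_seq big1 // => y yr /=; rewrite count_nseq /=.
  by case: eqVneq yr nrx => [-> -> | ].
have ur : uniq (rootsR (char_poly A)).
  by apply: (sorted_uniq lt_trans ltxx); apply: sorted_roots.
rewrite (bigD1_seq x) //= count_nseq /= eqxx mul1n big1 ?addn0 // => y.
by move=> /negPf yx; rewrite count_nseq /= yx.
Qed.

Lemma size_eigenvalues n (A : 'M[R]_n) : A^T = A -> size (eigenvalues A) = n.
Proof.
move=> /eigenvaluesP/(congr1 (fun p : {poly R} => size p)).
by rewrite size_char_poly size_prod_XsubC => -[].
Qed.

(* Only meaningful for n > 0; 0 is neutral since the entries are nonnegative. *)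
Definition delta n (c : R) (A : 'M[R]_n) : R :=
  \big[Num.max/0]_(a <- eigenvalues A) `|a - c|.

End Spectrum.

(* Main.v *)
Require Import Defs.
From mathcomp Require Import all_boot all_order all_algebra.
From mathcomp Require Import reals complex.
From mathcomp Require Import zify.
Import Order.TTheory GRing.Theory Num.Theory.
Local Open Scope ring_scope.
Local Open Scope sesquilinear_scope.

(** The lift has a symmetry that exchanges its two copies of G and fixes the hub,
    so its Laplacian splits along antisymmetric and symmetric vectors.  On an
    antisymmetric vector (x, 0, -x) the edges to the hub act as loops and the
    Laplacian is that of G_S.  On a symmetric vector (x, sqrt 2 h, x), whose
    squared length is twice that of (h, x), it acts on (h, x) as M_sym.  Hence
    the spectrum of the lift is the union, with multiplicity, of those of L(G_S)
    and M_sym ([eigenvalues_lift]).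

    Deleting the first row and column of M_sym leaves L(G_S), so by Cauchy
    interlacing the eigenvalues of L(G_S) separate those of M_sym.  Interlacing is
    used in its counting form ([cauchy_interlacing]): for every threshold t, if b
    eigenvalues of L(G_S) and a eigenvalues of M_sym exceed t, then
    b <= a <= b + 1.  The lift then has a + b eigenvalues above t, which is 2b or
    2b + 1, so its (2i)-th largest eigenvalue exceeds t exactly when b >= i, that
    is, exactly when the i-th largest eigenvalue of L(G_S) exceeds t.  As t is
    arbitrary, the two numbers are equal.

    Interlacing also confines the spectrum of L(G_S) between the extreme
    eigenvalues of M_sym ([delta_compression]), so only M_sym matters for the
    largest distance from c to the spectrum of the lift.

    The counting form of interlacing is an inertia argument: after a shift by t,
    eigenvectors with eigenvalue above t span a space where the quadratic form is
    positive definite, the others span one where it is nonpositive, and two such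
    spaces cannot meet, so their dimensions add up to at most n
    ([inertia_bound]).  Orthonormal eigenvectors are taken over the complex
    numbers R[i], where Hermitian matrices are unitarily diagonalizable. *)

(** * Characteristic polynomials *)

Lemma perm_eq_prod_XsubC {F : fieldType} (s1 s2 : seq F) :
  \prod_(x <- s1) ('X - x%:P) = \prod_(x <- s2) ('X - x%:P) -> perm_eq s1 s2.
Proof.
move=> e; apply/allP => x _ /=.
by rewrite -!mu_prod_XsubC e.
Qed.

(** Stated with an intertwining relation rather than a conjugation so that no
    inverse of P has to be computed. *)
Lemma char_poly_intertwine {F : fieldType} {n} (P A B : 'M[F]_n) :
  P \in unitmx -> P *m A = B *m P -> char_poly A = char_poly B.
Proof.
move=> Pu PA; have := congr1 (map_mx polyC) PA; rewrite !map_mxM => PA'.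
set Q := map_mx polyC P; have detQ : \det Q != 0.
  by rewrite det_map_mx polyC_eq0 -unitfE -unitmxE.
apply: (mulfI detQ); rewrite -[LHS]det_mulmx [RHS]mulrC -[RHS]det_mulmx.
congr (\det _); rewrite /char_poly_mx mulmxBr mulmxBl PA'.
by rewrite mul_mx_scalar mul_scalar_mx.
Qed.

(** * Inertia of Hermitian forms *)

Section Inertia.
Variable C : numClosedFieldType.

Lemma diag_formE {p} (d x : 'rV[C]_p) :
  (x *m diag_mx d *m x ^t*) 0 0 = \sum_i d 0 i * `|x 0 i| ^+ 2.
Proof.
rewrite mxE; apply: eq_bigr => i _.
by rewrite mul_mx_diag !mxE normCK mulrAC mulrC.
Qed.

(** A common nonzero vector of the two row spaces would have both a positive and
    a nonpositive value under the form K, so they meet trivially and their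
    dimensions add up inside a space of dimension n. *)
Lemma inertia_bound {n p q} (K : 'M[C]_n) (X : 'M[C]_(p, n)) (Y : 'M[C]_(q, n))
    (a : 'rV[C]_p) (b : 'rV[C]_q) :
  row_free X -> row_free Y ->
  X *m K *m X ^t* = diag_mx a -> Y *m K *m Y ^t* = diag_mx b ->
  (forall i, 0 < a 0 i) -> (forall i, b 0 i <= 0) -> (p + q <= n)%N.
Proof.
move=> /eqP rX /eqP rY XK YK a_gt0 b_le0; rewrite leqNgt; apply/negP => ltn.
have : (X :&: Y)%MS != 0.
  rewrite -mxrank_eq0 -lt0n -(ltn_add2l (\rank (X + Y)%MS)) addn0.
  by rewrite mxrank_sum_cap rX rY; apply: leq_ltn_trans ltn; apply: rank_leq_col.
case/rowV0Pn => v; rewrite sub_capmx => /andP[/submxP[x vx] /submxP[y vy]] v0.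
have form_v k (Z : 'M[C]_(k, n)) d z : Z *m K *m Z ^t* = diag_mx d -> v = z *m Z ->
    (v *m K *m v ^t*) 0 0 = \sum_i d 0 i * `|z 0 i| ^+ 2.
  move=> ZK ->; rewrite -diag_formE -ZK trmx_mul map_mxM.
  by rewrite !mulmxA.
have a_nonneg i : 0 <= a 0 i * `|x 0 i| ^+ 2.
  by rewrite mulr_ge0 ?exprn_ge0 // ltW.
have sum0 : \sum_i a 0 i * `|x 0 i| ^+ 2 = 0.
  apply/le_anti; rewrite sumr_ge0 ?andbT // -(form_v _ _ _ _ XK vx).
  rewrite (form_v _ _ _ _ YK vy) sumr_le0 // => i _.
  by rewrite mulr_le0_ge0 ?exprn_ge0.
move/eqP: v0; apply; rewrite vx; suff -> : x = 0 by rewrite mul0mx.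
apply/rowP => i; rewrite mxE.
have /(_ i isT)/eqP := psumr_eq0P (fun j _ => a_nonneg j) sum0.
by rewrite mulf_eq0 gt_eqF //= sqrf_eq0 normr_eq0 => /eqP.
Qed.

End Inertia.

(** * Eigenvectors of real symmetric matrices *)

Section Frames.
Variable R : rcfType.
Local Notation f := (real_complex R).

Lemma map_real_complex_adj {m n} (A : 'M[R]_(m, n)) :
  (map_mx f A) ^t* = map_mx f A^T.
Proof.
by apply/matrixP => i j; rewrite !mxE; apply/CrealP/complex_realP; exists (A j i).
Qed.

(** The diagonal form is real because A is Hermitian over R[i], and it lists
    exactly [eigenvalues A] because both factor the same characteristic
    polynomial. *)
Lemma spectral_decomposition {n} (A : 'M[R]_n) : A^T = A ->
  exists (P : 'M[R[i]]_n) (d : 'rV[R]_n),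
  [/\ P \is unitarymx, map_mx f A = P ^t* *m diag_mx (map_mx f d) *m P
    & perm_eq (eigenvalues A) [seq d 0 i | i <- enum 'I_n]].
Proof.
move=> Asym; pose B := map_mx f A.
have Bherm : B \is hermsymmx.
  apply/is_hermitianmxP.
  by rewrite expr0 scale1r map_real_complex_adj Asym.
have /mxOverP dreal := hermitian_spectral_diag_real Bherm.
have /orthomx_spectralP := hermitian_normalmx Bherm.
have Pu := spectral_unitarymx B.
rewrite invmx_unitary //.
set P := spectralmx B in Pu *; set d := spectral_diag B in dreal * => BE.
pose e : 'rV[R]_n := map_mx (fun z => complex.Re z) d.
have de : d = map_mx f e.
  by apply/rowP => i; rewrite !mxE /= RRe_real.
rewrite de in BE.
exists P, e; split => //.
apply: (@perm_map_inj _ _ f (@complexI R)); apply: perm_eq_prod_XsubC.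
rewrite [LHS]big_map -map_prod_XsubC -eigenvaluesP // map_char_poly -/B.
rewrite (char_poly_intertwine P _ (diag_mx (map_mx f e))) ?unitarymx_unit //; last first.
  by rewrite {1}BE !mulmxA (unitarymxP Pu) mul1mx.
rewrite char_poly_trig ?diag_mx_is_trig // 2!big_map big_enum /=.
by apply: eq_bigr => i _; rewrite !mxE eqxx mulr1n.
Qed.

(** Keeping only the eigenvectors whose eigenvalue satisfies p turns a count of
    eigenvalues into the number of rows of X, that is, into a dimension. *)
Lemma spectral_frame {n} (A : 'M[R]_n) (p : pred R) : A^T = A ->
  exists (X : 'M[R[i]]_(count p (eigenvalues A), n))
         (d : 'rV[R]_(count p (eigenvalues A))),
  [/\ X \is unitarymx, X *m map_mx f A *m X ^t* = diag_mx (map_mx f d)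
    & forall i, p (d 0 i)].
Proof.
move=> /spectral_decomposition[P [d [Pu AE /permP ->]]].
rewrite count_map.
have -> : count (preim (fun i => d 0 i) p) (enum 'I_n) = #|[pred i | p (d 0 i)]|.
  by rewrite cardE enumT -size_filter.
pose g (k : 'I_#|[pred i | p (d 0 i)]|) : 'I_n := enum_val k.
exists (rowsub g P), (colsub g d); split; last 1 first.
- by move=> k; rewrite mxE; exact: enum_valP k.
- apply/unitarymxP/matrixP => k l; rewrite !mxE.
  have /unitarymxP/matrixP/(_ (g k) (g l)) := Pu.
  rewrite !mxE (inj_eq enum_val_inj) => <-.
  by apply: eq_bigr => i _; rewrite !mxE.
- have -> : rowsub g P *m map_mx f A *m (rowsub g P) ^t*
       = mxsub g g (P *m map_mx f A *m P ^t*).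
    apply/matrixP => k l; rewrite !mxE; apply: eq_bigr => i _; rewrite !mxE.
    by congr (_ * _); apply: eq_bigr => j _; rewrite !mxE.
  rewrite AE !mulmxA (unitarymxP Pu) mul1mx -mulmxA (unitarymxP Pu) mulmx1.
  by apply/matrixP => k l; rewrite !mxE (inj_eq enum_val_inj).
Qed.
End Frames.

(** * Cauchy interlacing by counting *)

Definition count_gt {R : rcfType} (t : R) (s : seq R) : nat :=
  count (fun x => t < x) s.

Section Interlacing.
Variable R : rcfType.
Local Notation f := (real_complex R).

Lemma compression_sym {m n} (A : 'M[R]_n) (J : 'M[R]_(m, n)) :
  A^T = A -> (J *m A *m J^T)^T = J *m A *m J^T.
Proof. by move=> As; rewrite !trmx_mul trmxK As mulmxA. Qed.

(** Eigenvectors of the compression, carried back by the isometry J, diagonalize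
    the form A - t on the larger space. *)
Lemma compression_frame {m n} (A : 'M[R]_n) (J : 'M[R]_(m, n)) (p : pred R) (t : R)
    (k := count p (eigenvalues (J *m A *m J^T))) :
  A^T = A -> J *m J^T = 1%:M ->
  exists (X : 'M[R[i]]_(k, n)) (d : 'rV[R]_k),
  [/\ row_free X, X *m (map_mx f A - (f t)%:M) *m X ^t* = diag_mx (map_mx f (d - const_mx t))
    & forall i, p (d 0 i)].
Proof.
move=> Asym JJ.
have [X [d [Xu XB dp]]] := spectral_frame R (J *m A *m J^T) p (compression_sym A J Asym).
have adj : (X *m map_mx f J) ^t* = map_mx f J^T *m X ^t*.
  by rewrite trmx_mul map_mxM map_real_complex_adj.
have XJu : X *m map_mx f J *m (X *m map_mx f J) ^t* = 1%:M.
  by rewrite adj mulmxA -(mulmxA X) -map_mxM JJ map_mx1 mulmx1; apply/unitarymxP.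
exists (X *m map_mx f J), d; split => //.
  by apply/eqP; apply: mxrank_unitary; apply/unitarymxP.
rewrite mulmxBr mulmxBl mul_mx_scalar -scalemxAl XJu adj.
move: XB; rewrite !map_mxM !mulmxA => ->.
by apply/matrixP => i j; rewrite !mxE rmorphB mulrnBl /= mulr_natr.
Qed.

(** Comparing two compressions of the same form keeps the two halves of
    interlacing symmetric: they differ only by which isometry is trivial. *)
Lemma count_compressions {m1 m2 n} (A : 'M[R]_n) (J1 : 'M[R]_(m1, n)) (J2 : 'M[R]_(m2, n)) t :
  A^T = A -> J1 *m J1^T = 1%:M -> J2 *m J2^T = 1%:M ->
  (count_gt t (eigenvalues (J1 *m A *m J1^T))
   + count (fun x => x <= t)%R (eigenvalues (J2 *m A *m J2^T)) <= n)%N.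
Proof.
move=> Asym JJ1 JJ2.
have [X [a [Xf XA a_gt]]] := compression_frame A J1 (fun x => t < x) t Asym JJ1.
have [Y [b [Yf YA b_le]]] := compression_frame A J2 (fun x => x <= t) t Asym JJ2.
apply: (inertia_bound _ _ X Y _ _ Xf Yf XA YA) => i.
- by rewrite !mxE /= ltcR subr_gt0 a_gt.
- by rewrite !mxE /= lecR subr_le0 b_le.
Qed.

Lemma count_gt_le (s : seq R) t :
  (count_gt t s + count (fun x => x <= t)%R s = size s)%N.
Proof.
rewrite /count_gt -(count_predC (fun x => t < x)); congr addn.
by apply: eq_count => x /=; rewrite leNgt.
Qed.

(** Each inequality is an instance of [count_compressions] in which one of the two
    isometries is the identity. *)
Lemma cauchy_interlacing {m n} (A : 'M[R]_n) (J : 'M[R]_(m, n)) t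
    (B := J *m A *m J^T) :
  A^T = A -> J *m J^T = 1%:M ->
  (count_gt t (eigenvalues B) <= count_gt t (eigenvalues A)
     <= count_gt t (eigenvalues B) + (n - m))%N.
Proof.
move=> Asym JJ; have I1 : 1%:M *m (1%:M : 'M[R]_n)^T = 1%:M by rewrite trmx1 mulmx1.
have AI : 1%:M *m A *m 1%:M^T = A by rewrite trmx1 mulmx1 mul1mx.
have := count_compressions A J 1%:M t Asym JJ I1.
have := count_compressions A 1%:M J t Asym I1 JJ.
rewrite AI -/B.
have := count_gt_le (eigenvalues A) t; rewrite size_eigenvalues //.
have := count_gt_le (eigenvalues B) t; rewrite size_eigenvalues ?compression_sym //.
lia.
Qed.

(** * Order statistics and spectral distance *)

Lemma lt_nth_sorted (s : seq R) t k : sorted >=%O s -> (k < size s)%N ->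
  (t < s`_k) = (k < count_gt t s)%N.
Proof.
rewrite /count_gt; elim: s k => //= x s IH k; rewrite (path_sortedE ge_trans) => /andP[/allP xs ss].
have above0 : t < x = false -> count (fun y => t < y) s = 0%N.
  move=> /negbT; rewrite -leNgt => xt; apply/eqP; rewrite -leqn0 leqNgt -has_count.
  by apply/hasPn => y /xs yx; rewrite -leNgt (le_trans yx).
by case: k => [|k] ks /=; rewrite ?IH //; case tx: (t < x) => //; rewrite above0.
Qed.

(** Lets two order statistics be compared through [lt_nth_sorted]. *)
Lemma eq_lt_thresholds (x y : R) : (forall t, (t < x) = (t < y)) -> x = y.
Proof.
by move=> e; apply/le_anti; rewrite !leNgt -e ltxx e ltxx.
Qed.

Lemma sorted_eigenvalues {n} (A : 'M[R]_n) : sorted >=%O (eigenvalues A).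
Proof. by apply: sort_sorted; apply: ge_total. Qed.

Lemma delta_leP {n} (c e : R) (A : 'M[R]_n) : 0 <= e ->
  reflect (forall x, x \in eigenvalues A -> `|x - c| <= e) (delta c A <= e).
Proof.
move=> e0; apply: (iffP idP) => [le_e x xA | le_e].
  by apply: le_trans le_e; apply: (le_bigmax_seq 0 x xpredT (fun x => `|x - c|)).
by rewrite /delta big_seq; apply: bigmax_le => // x; apply: le_e.
Qed.

Lemma delta_ge0 {n} (c : R) (A : 'M[R]_n) : 0 <= delta c A.
Proof. exact: bigmax_ge_id. Qed.

Lemma le_delta {n} c (A : 'M[R]_n) x : x \in eigenvalues A -> `|x - c| <= delta c A.
Proof. exact: (elimT (delta_leP c _ A (delta_ge0 c A)) (lexx _)). Qed.

(** The eigenvalues of a compression lie between the extreme eigenvalues of A: one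
    lying further from c than all of them would violate [cauchy_interlacing] at a
    suitable threshold. *)
Lemma delta_compression {m n} (A : 'M[R]_n) (J : 'M[R]_(m, n)) c :
  A^T = A -> J *m J^T = 1%:M -> delta c (J *m A *m J^T) <= delta c A.
Proof.
move=> Asym JJ; have Bsym := compression_sym A J Asym.
apply/delta_leP => [|x xB]; first exact: delta_ge0.
rewrite ler_norml; apply/andP; split.
(* Below all of A: every eigenvalue of A exceeds x, so all m eigenvalues of the
   compression must exceed x, including x itself. *)
- rewrite leNgt; apply/negP => x_lt.
  have /andP[_] := cauchy_interlacing A J x Asym JJ.
  have -> : count_gt x (eigenvalues A) = n.
    rewrite -[RHS](size_eigenvalues Asym); apply/eqP; rewrite -all_count.
    apply/allP => y /(le_delta c); rewrite ler_norml => /andP[+ _].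
    by move=> /(lt_le_trans x_lt); rewrite ltrD2r.
  have := count_gt_le (eigenvalues (J *m A *m J^T)) x; rewrite size_eigenvalues //.
  have : (0 < count (fun y => y <= x)%R (eigenvalues (J *m A *m J^T)))%N.
    by rewrite -has_count; apply/hasP; exists x.
  have : (m <= n)%N.
    have <- : \rank J = m; last exact: rank_leq_col.
    by apply/eqP/row_freeP; exists J^T.
  lia.
(* Above all of A: no eigenvalue of A exceeds delta c A + c, so none of the
   compression does. *)
- rewrite lerBlDr leNgt; apply/negP => x_gt.
  have /andP[+ _] := cauchy_interlacing A J (delta c A + c) Asym JJ.
  have -> : count_gt (delta c A + c) (eigenvalues A) = 0%N.
    apply/eqP; rewrite -leqn0 leqNgt -has_count; apply/hasPn => y /(le_delta c).
    by rewrite ler_norml -leNgt lerBlDr => /andP[].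
  by rewrite leqn0 => /eqP/eqP; rewrite -leqn0 leqNgt -has_count => /hasPn/(_ x xB); rewrite x_gt.
Qed.
End Interlacing.

(** * The Laplacian of the lift *)

Section LiftSpectrum.
Variables (R : rcfType) (N : nat) (G : sgraph N) (S : {set 'I_N}).
Local Notation s := (loop_vec R S).
Local Notation LS := (loop_laplacian R G S).

Lemma laplacian_sym n (H : sgraph n) : (laplacian R H)^T = laplacian R H.
Proof.
rewrite /laplacian linearB /= tr_diag_mx; congr (_ - _).
by apply/matrixP => i j; rewrite !mxE edge_sym.
Qed.

Lemma loop_laplacian_sym : LS^T = LS.
Proof. by rewrite /loop_laplacian linearD /= laplacian_sym tr_diag_mx. Qed.

Lemma Msym_sym : (Msym R G S)^T = Msym R G S.
Proof.
by rewrite tr_block_mx tr_scalar_mx loop_laplacian_sym !linearZ /= trmxK.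
Qed.

Local Notation H := (acikmese_lift G S).

Lemma lift_copy1_copy1 i j : H (copy1 i) (copy1 j) = G i j.
Proof.
apply/idP/idP => [/orP[/existsP[k /existsP[l /andP[Gkl]]] | /existsP[k /andP[_]]]|Gij].
- rewrite !xpair_eqE => /orP[|/andP[]]; last by rewrite /copy1 /copy2 eq_lrshift.
  by move=> /andP[/eqP/lshift_inj-> /eqP/lshift_inj->].
- by rewrite !inE !xpair_eqE /hub /copy1 /copy2 !eq_lrshift ?andbF.
- by apply/orP; left; apply/existsP; exists i; apply/existsP; exists j; rewrite Gij eqxx.
Qed.

Lemma lift_copy2_copy2 i j : H (copy2 i) (copy2 j) = G i j.
Proof.
apply/idP/idP => [/orP[/existsP[k /existsP[l /andP[Gkl]]] | /existsP[k /andP[_]]]|Gij].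
- rewrite !xpair_eqE => /orP[/andP[]|]; first by rewrite /copy1 /copy2 eq_rlshift.
  by move=> /andP[/eqP/rshift_inj/rshift_inj-> /eqP/rshift_inj/rshift_inj->].
- rewrite !inE !xpair_eqE /hub /copy1 /copy2.
  by rewrite !(eq_lrshift, eq_rlshift, eq_rshift) ?andbF.
- apply/orP; left; apply/existsP; exists i; apply/existsP; exists j.
  by rewrite Gij eqxx orbT.
Qed.

Lemma lift_copy1_copy2 i j : H (copy1 i) (copy2 j) = false.
Proof.
apply/negP => /orP[/existsP[k /existsP[l /andP[Gkl]]] | /existsP[k /andP[_]]];
rewrite ?inE !xpair_eqE /hub /copy1 /copy2;
by rewrite !(eq_lrshift, eq_rlshift, eq_rshift) ?andbF.
Qed.

Lemma lift_copy1_hub i : H (copy1 i) (hub N) = (i \in S).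
Proof.
apply/idP/idP => [/orP[/existsP[k /existsP[l /andP[Gkl]]] | /existsP[k /andP[Sk]]]|Si].
- rewrite !xpair_eqE /hub /copy1 /copy2.
  by rewrite !(eq_lrshift, eq_rlshift, eq_rshift) ?andbF.
- rewrite !inE !xpair_eqE eqxx !andbT => /orP[/eqP/lshift_inj-> //|].
  by rewrite /hub /copy1 /copy2 !(eq_lrshift, eq_rlshift, eq_rshift) ?andbF.
- by apply/orP; right; apply/existsP; exists i; rewrite Si !inE eqxx.
Qed.

Lemma lift_copy2_hub i : H (copy2 i) (hub N) = (i \in S).
Proof.
apply/idP/idP => [/orP[/existsP[k /existsP[l /andP[Gkl]]] | /existsP[k /andP[Sk]]]|Si].
- rewrite !xpair_eqE /hub /copy1 /copy2.
  by rewrite !(eq_lrshift, eq_rlshift, eq_rshift) ?andbF.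
- rewrite !inE !xpair_eqE eqxx !andbT => /or4P[||| /eqP/rshift_inj/rshift_inj-> //];
  by rewrite /hub /copy1 /copy2 !(eq_lrshift, eq_rlshift, eq_rshift) ?andbF.
- by apply/orP; right; apply/existsP; exists i; rewrite Si !inE eqxx !orbT.
Qed.

Lemma adjacency_lift : adjacency R H =
  block_mx (adjacency R G)  (row_mx s 0)
           (col_mx s^T 0)   (block_mx 0 s^T s (adjacency R G)).
Proof.
apply/matrixP => x y; rewrite mxE.
case: (split_ordP x) => [i|x'] ->; [|case: (split_ordP x') => i ->; [rewrite (ord1 i)|]];
(case: (split_ordP y) => [j|y'] ->; [|case: (split_ordP y') => j ->; [rewrite (ord1 j)|]]);
rewrite ?(block_mxEul, block_mxEur, block_mxEdl, block_mxEdr, row_mxEl, row_mxEr, col_mxEu, col_mxEd);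
rewrite ?mxE.
- by rewrite lift_copy1_copy1.
- by rewrite lift_copy1_hub.
- by rewrite lift_copy1_copy2.
- by rewrite edge_sym lift_copy1_hub.
- by rewrite edge_irr.
- by rewrite edge_sym lift_copy2_hub.
- by rewrite edge_sym lift_copy1_copy2.
- by rewrite lift_copy2_hub.
- by rewrite lift_copy2_copy2.
Qed.

(** Degrees as row sums, so that they can be computed blockwise. *)
Lemma degree_mxE n (K : sgraph n) :
  degree_mx R K = diag_mx (adjacency R K *m const_mx 1)^T.
Proof.
congr diag_mx; apply/rowP => i; rewrite !mxE -sum1_card natr_sum.
rewrite (big_mkcond (fun j => j \in _)) /=.
by apply: eq_bigr => j _; rewrite !mxE inE mulr1; case: (K i j).
Qed.

Lemma sum_loop_vec : s^T *m const_mx 1 = (#|S|%:R)%:M :> 'M[R]_1.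
Proof.
apply/rowP => i; rewrite ord1 !mxE mulr1n -sum1_card natr_sum.
rewrite [RHS]big_mkcond /=; apply: eq_bigr => j _; rewrite !mxE mulr1.
by case: (j \in S).
Qed.

(** Seen from either copy, an edge to the hub contributes to the diagonal exactly
    what a loop contributes in G_S. *)
Lemma laplacian_lift : laplacian R H =
  block_mx LS                 (row_mx (- s) 0)
           (col_mx (- s^T) 0) (block_mx (2 * #|S|%:R)%:M (- s^T) (- s) LS).
Proof.
rewrite /loop_laplacian /laplacian !degree_mxE adjacency_lift.
have -> : const_mx 1 = col_mx (const_mx 1) (col_mx (const_mx 1) (const_mx 1)) :> 'cV[R]_(N + (1 + N)).
  by rewrite !col_mx_const.
rewrite !(mul_block_col, mul_row_col, mul_col_mx) !mul0mx !addr0 add0r.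
have s1 : s *m const_mx 1 = s :> 'cV[R]_N.
  by apply/colP => i; rewrite !mxE big_ord1 !mxE mulr1.
rewrite !add_col_mx !s1 !(add0r, addr0) sum_loop_vec.
rewrite !tr_col_mx !diag_mx_row !opp_block_mx !add_block_mx.
rewrite !(opp_row_mx, opp_col_mx, add0r, oppr0).
have LSE : diag_mx (adjacency R G *m const_mx 1 + s)^T - adjacency R G
    = diag_mx (adjacency R G *m const_mx 1)^T - adjacency R G + diag_mx s^T.
  by rewrite linearD linearD /= addrAC.
rewrite [s + _]addrC LSE; do 2!congr block_mx.
by rewrite addr0 -raddfD /= tr_scalar_mx mulr_natl mulr2n; apply/matrixP => i j; rewrite !ord1 !mxE.
Qed.

(** The columns are the antisymmetric vectors (e_i, 0, -e_i), the hub vector, and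
    the symmetric vectors (e_i, 0, e_i).  The hub vector is scaled by sqrt 2 so that
    all columns have the same length, which is what makes the symmetric block equal
    to the symmetric matrix [Msym]. *)
Definition sym_antisym_basis : 'M[R]_(N + (1 + N)) :=
  block_mx 1%:M                   (row_mx 0 1%:M)
           (col_mx 0 (- 1%:M))    (block_mx (Num.sqrt 2)%:M 0 0 1%:M).
Local Notation T := sym_antisym_basis.

Lemma sym_antisym_basis_unit : T \in unitmx.
Proof.
have r2 : Num.sqrt 2 * Num.sqrt 2 = 2 :> R by rewrite -expr2 sqr_sqrtr.
have TT : T *m T^T = 2%:M.
  rewrite /T tr_block_mx tr_row_mx tr_col_mx tr_block_mx !linearN /= !tr_scalar_mx !trmx0.
  rewrite mulmx_block !(mul_row_col, mul_col_row, mul_mx_row, mul_col_mx, mulmx_block, mul_row_block, mul_block_col).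
  rewrite ?(mulmx0, mul0mx, mulmx1, mul1mx, mulmxN, mulNmx, opprK, oppr0, add0r, addr0).
  rewrite !scalar_mx_block /block_mx !(add_row_mx, add_col_mx).
  rewrite -scalar_mxM r2 !(add0r, addr0, oppr0, addNr) -?raddfD /= row_mx0 col_mx0.
  by rewrite -[1 + 1]/(2%:R).
have /mulmx1_unit[] // : T *m (2^-1 *: T^T) = 1%:M.
by rewrite -scalemxAr TT scale_scalar_mx mulVf // pnatr_eq0.
Qed.

Lemma laplacian_lift_sym_antisym :
  T *m block_mx LS 0 0 (Msym R G S) = laplacian R H *m T.
Proof.
have r2 : Num.sqrt 2 * Num.sqrt 2 = 2 :> R by rewrite -expr2 sqr_sqrtr.
rewrite laplacian_lift /T /Msym.
rewrite !(mulmx_block, mul_row_col, mul_col_row, mul_mx_row, mul_col_mx, mul_row_block, mul_block_col).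
rewrite ?(mulmx0, mul0mx, mulmx1, mul1mx, mulmxN, mulNmx, opprK, oppr0, add0r, addr0).
rewrite /block_mx !(add_row_mx, add_col_mx).
rewrite ?(mulmx0, mul0mx, mulmx1, mul1mx, mulmxN, mulNmx, opprK, oppr0, add0r, addr0).
rewrite addNr (mul_mx_scalar _ s) !scaleNr scalar_mxC mulmxN.
rewrite (mul_scalar_mx _ (_ *: _)) scalerA r2.
by rewrite -(opprD s^T) -mulr2n scaler_nat.
Qed.

Lemma eigenvalues_lift :
  perm_eq (eigenvalues (laplacian R H))
          (eigenvalues LS ++ eigenvalues (Msym R G S)).
Proof.
apply: perm_eq_prod_XsubC; rewrite big_cat /= -!eigenvaluesP ?laplacian_sym ?loop_laplacian_sym ?Msym_sym //.
rewrite -(char_poly_intertwine T _ _ sym_antisym_basis_unit laplacian_lift_sym_antisym).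
by rewrite /char_poly char_block_diag_mx det_ublock.
Qed.
End LiftSpectrum.

(** * Interlacing of the two parts of the spectrum *)

(** The isometry J deletes the hub coordinate. *)
Lemma loop_laplacian_compression (R : rcfType) (N : nat) (G : sgraph N) (S : {set 'I_N})
    (J := row_mx 0 1%:M : 'M[R]_(N, 1 + N)) :
  J *m J^T = 1%:M /\ J *m Msym R G S *m J^T = loop_laplacian R G S.
Proof.
rewrite /J tr_row_mx trmx0 trmx1 mul_row_col mulmx1 mul0mx add0r; split => //.
by rewrite mul_row_block mul_row_col !mul0mx !mul1mx mulmx1 mulmx0 !add0r.
Qed.

(** The two sides exceed the same thresholds t: with b and a the numbers of
    eigenvalues of L(G_S) and M_sym above t, the sum a + b is 2b or 2b + 1, so that
    2k + 1 < a + b if and only if k < b. *)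
Lemma nth_eigenvalues_lift (R : rcfType) (N : nat) (G : sgraph N) (S : {set 'I_N}) k :
  (k < N)%N ->
  (eigenvalues (loop_laplacian R G S))`_k
  = (eigenvalues (laplacian R (acikmese_lift G S)))`_(2 * k + 1).
Proof.
move=> kN; apply: eq_lt_thresholds => t.
have [JJ JM] := loop_laplacian_compression R N G S.
have := cauchy_interlacing _ _ _ t (Msym_sym R N G S) JJ; rewrite JM.
rewrite !lt_nth_sorted ?sorted_eigenvalues ?size_eigenvalues ?laplacian_sym ?loop_laplacian_sym //.
2: lia.
have -> : count_gt t (eigenvalues (laplacian R (acikmese_lift G S)))
    = (count_gt t (eigenvalues (loop_laplacian R G S))
       + count_gt t (eigenvalues (Msym R G S)))%N.
  by rewrite /count_gt (permP (eigenvalues_lift R N G S)) count_cat.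
lia.
Qed.

Theorem theorem3p8 (R : realType) (N : nat) (G : sgraph N) (S : {set 'I_N})
    (S_gt0 : (1 <= #|S|)%N) :
  (forall i : nat, (1 <= i <= N)%N ->
     (eigenvalues (loop_laplacian R G S))`_(i - 1)
     = (eigenvalues (laplacian R (acikmese_lift G S)))`_(2 * i - 1))
  /\ (forall c : R,
        delta c (laplacian R (acikmese_lift G S)) = delta c (Msym R G S)
        /\ delta c (Msym R G S) >= delta c (loop_laplacian R G S)).
Proof.
split=> [i iN|c].
  by rewrite nth_eigenvalues_lift; [congr nth; lia | lia].
have [JJ JM] := loop_laplacian_compression R N G S.
have le_LS : delta c (loop_laplacian R G S) <= delta c (Msym R G S).
  by rewrite -JM; apply: delta_compression => //; apply: Msym_sym.
split=> //; apply/le_anti/andP; split; apply/delta_leP; rewrite ?delta_ge0 // => x xA.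
- have : x \in eigenvalues (loop_laplacian R G S) ++ eigenvalues (Msym R G S).
    by rewrite -(perm_mem (eigenvalues_lift R N G S)).
  rewrite mem_cat => /orP[/le_delta-/(_ c) x_le|]; last exact: le_delta.
  exact: le_trans x_le le_LS.
- by apply: le_delta; rewrite (perm_mem (eigenvalues_lift R N G S)) mem_cat xA orbT.
Qed.
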